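(* Let $F:\mathbb R^m\times\mathbb R^n\to\mathbb R^m$ be continuous in a neighborhood of the origin, $F(0,0)=0$, with $\delta\mapsto F(\delta,0)$ differentiable at $\delta=0$, and $\partial_\delta F(0,0)$ invertible. Then, for $|a|$ sufficiently small, there exists a solution $\delta=\delta(a)$ of $F(\delta(a),a)=0$, $\delta(0)=0$, with $\delta(\cdot)$ continuous at $a=0$.
   Context: Points of $\mathbb R^m\times\mathbb R^n$ are written $(\delta,a)$; $\partial_\delta F(0,0)$ is the derivative at $\delta=0$ of $\delta\mapsto F(\delta,0)$. *)

(* Defs.v *)
From mathcomp Require Import all_boot all_order all_algebra.
From mathcomp Require Import all_classical all_reals.
From mathcomp Require Import topology normedtype landau derive.
Set Implicit Arguments.
Unset Strict Implicit.
Unset Printing Implicit Defensive.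

(* Main.v *)
From HB Require Import structures.
From Stdlib Require List.
Require Import Defs.
From mathcomp Require Import all_boot all_order all_algebra.
From mathcomp Require Import all_classical all_reals.
From mathcomp Require Import topology normedtype landau derive.
From mathcomp Require Import zify ring lra.
Set Implicit Arguments.
Unset Strict Implicit.
Unset Printing Implicit Defensive.
Import Order.TTheory GRing.Theory Num.Theory.
Import numFieldNormedType.Exports.
Local Open Scope classical_set_scope.
Local Open Scope ring_scope.

(** Since F is only continuous, no contraction argument applies, and the zeros
come from degree theory.  Let g be the inverse of the derivative.  For fixed a,
zeros of F (., a) are zeros of G d := g (F (d, a)), and differentiability gives
|g (F (d, 0)) - d| <= |d| / 2 for small d.  On a small compact cube |d| <= r (the
norm of row vectors is the sup norm), uniform continuity in d shows that
|G d - d| <= r once a is small.  Thus the j-th coordinate of G is nonpositive on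
the face d_j = - r and nonnegative on the face d_j = r, and the Poincare-Miranda
theorem [poincare_miranda] yields a zero of G in the cube: this is
[small_zeros].  A solution of almost minimal norm among all solutions for the
given a ([near_minimal_selection]) then has to tend to 0 with a, because
arbitrarily small solutions exist.

The Poincare-Miranda theorem follows, by compactness, from a combinatorial
statement on fine grids ([miranda_approx]): if the sign of each G_j is recorded
on a grid, some small cell sees a sign change of every coordinate.  The cube is
doubled by reflection into a torus (Z/M)^n, so that there are no boundary terms.
The sign labels s_j : (Z/M)^n -> Z/2 then give 1-cochains ds_j + c_j, where c_j
is the cocycle dual to the j-th circle; ds_j + c_j vanishes on the steps closing
that circle, and elsewhere it detects the changes of s_j.  Adding coboundaries
does not affect the evaluation of a cup product of cocycles on the fundamental
class ([cup_total_cohomologous]), and the product of the c_j evaluates to 1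
([cup_total_wraps]).  So some term in the cup product of the ds_j + c_j is
nonzero: it is a short path along which every label changes
([torus_labels_change]).

Working modulo 2 removes all signs.  Cup products are treated as operators
[wedge w] on functions of a base point and a set of used directions; the operator
d of the constant cochain 1 commutes with [wedge w] for w a cocycle
([wedge_dC]), [wedge (coboundary u)] is the commutator of d with multiplication
by u ([wedge_coboundary]), and the evaluation behaves as a trace
([total_d]), so it kills such commutators. *)

(** * Mod 2 cup products on a finite abelian group *)

Section CupProducts.
Variables (K : comNzRingType) (V : finZmodType) (I : finType) (e : I -> V).
Hypothesis K2 : 2%N \in [pchar K].
Implicit Types (w c : V -> I -> K) (u : V -> K) (f : V -> {set I} -> K).
Implicit Types (v : V) (a b : I) (A : {set I}).

(** Both sides are the sums along the two ways around the square at v spanned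
by the steps e a and e b. *)
Definition cocycle w :=
  forall v a b, w v a + w (v + e a) b = w v b + w (v + e b) a.

Definition coboundary u : V -> I -> K := fun v a => u (v + e a) - u v.

(** f v A is to be thought of as a total weight of paths that start at v and have
already used the directions in A; [wedge w f] prepends one step, in a new
direction and weighted by w. *)
Definition wedge w f : V -> {set I} -> K :=
  fun v A => \sum_(a | a \notin A) w v a * f (v + e a) (a |: A).

(** The weight of the empty path: all directions must have been used. *)
Definition topform : V -> {set I} -> K := fun _ A => [forall a, a \in A]%:R.

(** The cup product of the ws, one for each direction, evaluated on the sum of all
unit cubes: this amounts to summing, over all base points and all orderings of
the directions, the product of the ws along the resulting path. *)
Definition cup_total (ws : seq (V -> I -> K)) : K :=
  \sum_v foldr wedge topform ws v finset.set0.

Local Notation d := (wedge (fun _ _ => 1)).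

Definition scale u f : V -> {set I} -> K := fun v A => u v * f v A.

(** Contraction by the a-th basis vector, modulo 2. *)
Definition contract a f : V -> {set I} -> K :=
  fun v A => if a \in A then 0 else f v (a |: A).

Lemma wedge_ext w f g : f =2 g -> wedge w f =2 wedge w g.
Proof. by move=> fg v A; apply: eq_bigr => a _; rewrite fg. Qed.

Lemma wedgeD w f g :
  wedge w (fun v A => f v A + g v A) =2 (fun v A => wedge w f v A + wedge w g v A).
Proof.
by move=> v A; rewrite -big_split; apply: eq_bigr => a _; rewrite mulrDr.
Qed.

(** Modulo 2, the off-diagonal terms of a symmetric sum cancel in pairs. *)
Lemma sum_symmetric_offdiag A (G : I -> I -> K) :
  (forall a b, G a b = G b a) ->
  \sum_(a | a \notin A) \sum_(b | b \notin a |: A) G a b = 0.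
Proof.
move=> Gsym; rewrite pair_big_dep/=.
rewrite (bigID (fun p : I * I => (enum_rank p.1 < enum_rank p.2)%N))/=.
have swapI : involutive (fun p : I * I => (p.2, p.1)) by case.
rewrite [X in _ + X](reindex_inj (inv_inj swapI))/=.
rewrite [X in _ + X](eq_big (fun p : I * I => (p.1 \notin A) &&
    (p.2 \notin p.1 |: A) && (enum_rank p.1 < enum_rank p.2)%N)
    (fun p => G p.1 p.2)); first by rewrite addrr_pchar2.
- move=> -[a b]/=; rewrite !inE -leqNgt ltn_neqAle (inj_eq val_inj).
  rewrite (inj_eq enum_rank_inj) [b == a]eq_sym.
  by case: (a == b); case: (a \in A); case: (b \in A).
- by move=> -[a b] _ /=; rewrite Gsym.
Qed.

(** Expanding both sides over two new directions, the sum of the two weights is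
the symmetric expression of the cocycle condition. *)
Lemma wedge_dC w f : cocycle w -> wedge w (d f) =2 d (wedge w f).
Proof.
move=> wcl v A; apply/eqP; rewrite -subr_eq0 (oppr_pchar2 K2); apply/eqP.
rewrite -big_split/=.
pose G a b := (w v a + w (v + e a) b) * f (v + e a + e b) (b |: (a |: A)).
rewrite -[RHS](@sum_symmetric_offdiag A G); last first.
  by move=> a b; rewrite /G wcl (addrAC v) finset.setUCA.
apply: eq_bigr => a _; rewrite mul1r mulr_sumr -big_split/=.
by apply: eq_bigr => b _; rewrite /G mul1r mulrDl.
Qed.

(** The Leibniz rule d (u f) = du f + u df, read modulo 2. *)
Lemma wedge_coboundary u f :
  wedge (coboundary u) f =2
  (fun v A => d (scale u f) v A + scale u (d f) v A).
Proof.
move=> v A; rewrite /wedge /scale mulr_sumr -big_split/=.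
apply: eq_bigr => a _.
by rewrite /coboundary (oppr_pchar2 K2) !mul1r mulrDl.
Qed.

Lemma contract_wedge a w f :
  contract a (wedge w f) =2 wedge w (contract a f).
Proof.
move=> v A; rewrite /contract /wedge; case: ifPn => aA.
  by rewrite big1// => b _; rewrite !inE aA orbT mulr0.
rewrite [RHS](bigID (fun b => b != a)) /= [X in _ = _ + X]big1 ?addr0; last first.
  by move=> b /andP[_]; rewrite negbK => /eqP ->; rewrite !inE eqxx mulr0.
apply: eq_big => [b|b]; first by rewrite !inE negb_or andbC.
rewrite !inE negb_or => /andP[ba bA].
by rewrite [a == b]eq_sym (negbTE ba) (negbTE aA)/= finset.setUCA.
Qed.

(** What the trace argument needs of the operators built from [wedge] and
[scale]. *)
Definition contract_linear (X : (V -> {set I} -> K) -> V -> {set I} -> K) :=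
  [/\ forall f g, f =2 g -> X f =2 X g,
      forall f g, X (fun v A => f v A + g v A) =2 (fun v A => X f v A + X g v A)
    & forall a f, contract a (X f) =2 X (contract a f)].

Lemma contract_linear_wedge w : contract_linear (wedge w).
Proof.
by split=> [f g||a f]; [exact: wedge_ext | exact: wedgeD | exact: contract_wedge].
Qed.

Lemma contract_linear_scale u : contract_linear (scale u).
Proof.
split=> [f g fg v A|f g v A|a f v A]; rewrite /scale ?fg ?mulrDr//.
by rewrite /contract; case: ifP => //; rewrite mulr0.
Qed.

Lemma contract_linear_id : contract_linear id.
Proof. by split. Qed.

Lemma contract_linear_comp X Y :
  contract_linear X -> contract_linear Y -> contract_linear (X \o Y).
Proof.
move=> [Xe Xd Xc] [Ye Yd Yc]; split=> [f g fg|f g v A|a f v A] /=.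
- by apply: Xe; apply: Ye.
- by rewrite (Xe _ _ (Yd f g)) Xd.
- by rewrite Xc; apply: Xe; apply: Yc.
Qed.

Lemma contract_linear_foldr ws : contract_linear (fun f => foldr wedge f ws).
Proof.
elim: ws => [|w ws IH]; first exact: contract_linear_id.
exact: contract_linear_comp (contract_linear_wedge w) IH.
Qed.

(** Cyclicity of the trace: d is the sum over a of translation by e a followed by
contraction by a.  The contraction commutes with X, the translation disappears
in the sum over v on one side, and fixes the constant [topform] on the other. *)
Lemma total_d X : contract_linear X ->
  \sum_v d (X topform) v finset.set0 = \sum_v X (d topform) v finset.set0.
Proof.
move=> [Xe Xd Xc].
have X0 v A : X (fun _ _ => 0) v A = 0.
  apply: (addrI (X (fun _ _ => 0) v A)); rewrite addr0 -Xd.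
  by apply: Xe => ? ?; rewrite addr0.
have dtop : d topform =2 (fun v A => \sum_a contract a topform v A).
  move=> v A; rewrite /wedge big_mkcond; apply: eq_bigr => a _.
  by rewrite /contract; case: (a \in A) => //=; rewrite mul1r.
have Xsum (s : seq I) v A :
    X (fun v A => \sum_(a <- s) contract a topform v A) v A =
    \sum_(a <- s) X (contract a topform) v A.
  elim: s v A => [|a s IH] v A.
    by rewrite big_nil -[RHS](X0 v A); apply: Xe => ? ?; rewrite big_nil.
  rewrite big_cons -IH -Xd; apply: Xe => ? ?; by rewrite big_cons.
rewrite [RHS](eq_bigr (fun v => \sum_a X topform v (a |: finset.set0))); last first.
  move=> v _; rewrite (Xe _ _ dtop) Xsum; apply: eq_bigr => a _.
  by rewrite -Xc /contract inE.
rewrite [RHS]exchange_big [LHS]exchange_big /=.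
apply: eq_big => [a|a _]; first by rewrite inE.
rewrite [RHS](reindex_inj (addIr (e a))).
by apply: eq_bigr => v _; rewrite mul1r.
Qed.

Lemma foldr_dC ws f : List.Forall cocycle ws ->
  foldr wedge (d f) ws =2 d (foldr wedge f ws).
Proof.
elim=> [//|w {}ws wc _ IH] v A /=.
by rewrite -wedge_dC//; apply: wedge_ext; exact: IH.
Qed.

(** With du = d u + u d, the two resulting terms are brought to the forms d X and
X d by moving d across the cocycles on either side; they have the same trace,
hence cancel modulo 2. *)
Lemma cup_total_coboundary ws1 u ws2 :
  List.Forall cocycle ws1 ->
  List.Forall cocycle ws2 ->
  cup_total (ws1 ++ coboundary u :: ws2) = 0.
Proof.
move=> c1 c2; rewrite /cup_total.
pose X1 f := foldr wedge f ws1; pose X2 f := foldr wedge f ws2.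
pose X := X1 \o scale u \o X2.
have [X1e X1d _] : contract_linear X1 := contract_linear_foldr ws1.
have Xc : contract_linear X.
  apply: contract_linear_comp (contract_linear_foldr _).
  exact: contract_linear_comp (contract_linear_foldr _) (contract_linear_scale u).
have Xe : forall f g, f =2 g -> X1 f =2 X1 g by [].
rewrite (eq_bigr (fun v => d (X topform) v finset.set0 + X (d topform) v finset.set0)).
  by rewrite big_split/= total_d// addrr_pchar2.
move=> v _; rewrite foldr_cat/= -/(X1 _) -/(X2 _).
rewrite (X1e _ _ (wedge_coboundary u _)) X1d.
congr (_ + _); first by rewrite /X1 foldr_dC.
by apply: X1e => w B; rewrite /scale /X2 foldr_dC.
Qed.

Lemma cup_totalD ws1 w w' ws2 :
  cup_total (ws1 ++ (fun v a => w v a + w' v a) :: ws2) =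
  cup_total (ws1 ++ w :: ws2) + cup_total (ws1 ++ w' :: ws2).
Proof.
rewrite /cup_total -big_split/=; apply: eq_bigr => v _.
have [Xe Xd _] := contract_linear_foldr ws1.
rewrite !foldr_cat -Xd/=; apply: Xe => v' A.
by rewrite /wedge -big_split/=; apply: eq_bigr => a _; rewrite mulrDl.
Qed.

Lemma cocycle_coboundary u : cocycle (coboundary u).
Proof.
move=> v a b; rewrite /coboundary ![_ - u v + _]addrC !addrA !subrK.
by rewrite (addrAC v).
Qed.

Lemma cup_total_cohomologous (J : Type) (c : J -> V -> I -> K)
    (u : J -> V -> K) (js : seq J) : (forall j, cocycle (c j)) ->
  cup_total [seq (fun v a => c j v a + coboundary (u j) v a) | j <- js] =
  cup_total [seq c j | j <- js].
Proof.
move=> ccl; pose cu j v a := c j v a + coboundary (u j) v a.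
have cucl j : cocycle (cu j).
  move=> v a b; rewrite /cu addrACA ccl (cocycle_coboundary (u j) v a b).
  by rewrite addrACA.
have map_cocycle (w : J -> V -> I -> K) ks : (forall j, cocycle (w j)) ->
    List.Forall cocycle (map w ks).
  by move=> wcl; elim: ks => [|j ks IH]; constructor.
suff H ws1 : List.Forall cocycle ws1 ->
    cup_total (ws1 ++ map cu js) = cup_total (ws1 ++ map c js).
  exact: (H [::] (List.Forall_nil _)).
elim: js ws1 => [//|j js IH] ws1 ws1c /=.
rewrite cup_totalD (cup_total_coboundary _ ws1c (map_cocycle _ _ cucl)) addr0.
rewrite -!cat_rcons IH// -cats1; apply/List.Forall_app; split => //.
by constructor => //; constructor.
Qed.

(** A nonzero value needs a path with nonzero weight; pt and h measure how far
such a path can wander from its start. *)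
Lemma foldr_wedge_neq0 (R : realFieldType) (U : normedZmodType R)
    (pt : V -> U) (h : R) (J : eqType) (w : J -> V -> I -> K) (js : seq J)
    f v A :
  0 <= h -> (forall v a, `|pt (v + e a) - pt v| <= h) ->
  foldr wedge f [seq w j | j <- js] v A != 0 ->
  forall j, j \in js -> exists v' a,
    w j v' a != 0 /\ `|pt v' - pt v| <= h *+ size js.
Proof.
move=> h0 pth; elim: js v A => [//|j0 js IH] v A /= nz.
have [a /andP[wa fa]] : exists a, (w j0 v a != 0) &&
    (foldr wedge f [seq w j | j <- js] (v + e a) (a |: A) != 0).
  apply/existsP; apply: contraNT nz => /existsPn nz.
  rewrite /wedge big1// => a _; have := nz a.
  by rewrite negb_and !negbK => /orP[] /eqP ->; rewrite ?mul0r ?mulr0.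
move=> j; rewrite inE => /orP[/eqP -> | jjs].
  by exists v, a; split=> //; rewrite subrr normr0 mulrn_wge0.
have [v' [b [wb dist]]] := IH _ _ fa j jjs.
exists v', b; split => //; rewrite mulrSr.
rewrite -(subrKA (pt (v + e a))); apply: le_trans (ler_normD _ _) _.
by rewrite lerD.
Qed.
End CupProducts.

(** * Labels on a discrete torus *)

Section DiscreteTorus.
Variables (q n : nat).
Local Notation V := 'rV['I_q.+2]_n.
Implicit Types (v : V) (a b j : 'I_n) (A : {set 'I_n}).

Local Notation e := (fun a : 'I_n => delta_mx 0 a : V).

(** The cocycle dual to the j-th circle: it detects the steps that close it. *)
Definition wraps j v a : bool := (a == j) && (v 0 j == ord_max).

Lemma torus_step_neq v a j : a != j -> (v + e a) 0 j = v 0 j.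
Proof. by move=> aj; rewrite !mxE eqxx eq_sym (negbTE aj) addr0. Qed.

Lemma torus_step_eq v j : (v + e j) 0 j = ((v 0%R j).+1 %% q.+2)%N :> nat.
Proof. by rewrite !mxE !eqxx /= addn1. Qed.

Lemma wraps_cocycle j : cocycle e (wraps j).
Proof.
move=> v a b; rewrite /wraps.
have [->|aj] := eqVneq a j; have [->|bj] := eqVneq b j => //=.
- by rewrite torus_step_neq// addrC.
- by rewrite torus_step_neq// addrC.
Qed.

(** The j-th factor only allows a step in direction j, so a single ordering
contributes, and the other steps leave coordinate j unchanged. *)
Lemma foldr_wraps (js : seq 'I_n) v A : uniq js -> {in js, forall j, j \notin A} ->
  foldr (wedge e) (@topform _ _ _) [seq wraps j | j <- js] v A =
  all (fun j => v 0 j == ord_max) js && [forall a, (a \in A) || (a \in js)].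
Proof.
elim: js v A => [|j js IH] v A /=.
  move=> _ _; rewrite /topform; under [in RHS]eq_forallb do rewrite orbF.
  by case: [forall a, _].
move=> /andP[jjs ujs] jA; rewrite /wedge (bigD1 j) /=; last first.
  by rewrite jA// inE eqxx.
rewrite big1 ?addr0 => [|a /andP[_ aj]]; last by rewrite /wraps (negbTE aj) mul0r.
rewrite IH//; last first.
  move=> i ijs; rewrite !inE negb_or jA ?inE ?ijs ?orbT// andbT.
  by apply: contraNneq jjs => <-.
rewrite /wraps eqxx /= -andbA; congr (_ && (_ && _)).
- apply: eq_in_all => i ijs; rewrite torus_step_neq//.
  by apply: contraNneq jjs => ->.
- by apply: eq_forallb => a; rewrite !inE orbCA orbA.
Qed.

Lemma cup_total_wraps : cup_total e [seq wraps j | j <- enum 'I_n] = true.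
Proof.
rewrite /cup_total (bigD1 (const_mx ord_max : V))//= big1 ?addr0 => [|v vmax].
- rewrite foldr_wraps ?enum_uniq//; last by move=> j _; rewrite inE.
  apply/andP; split; first by apply/allP => j _; rewrite mxE.
  by apply/forallP => a; rewrite mem_enum orbT.
- rewrite foldr_wraps ?enum_uniq//; last by move=> j _; rewrite inE.
  apply/negbTE; apply: contra vmax => /andP[/allP vmax _].
  by apply/eqP/rowP => j; rewrite mxE; apply/eqP/vmax; rewrite mem_enum.
Qed.

(** A cubical relative of Sperner's lemma.  The cochain ds_j + c_j, with c_j dual to
the j-th circle, is nonzero only on steps where s j changes and which do not
close that circle, while the cup product over all j is that of the c_j, namely 1;
a path of nonzero weight supplies the steps. *)
Lemma torus_labels_change (R : realFieldType) (U : normedZmodType R)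
    (pt : V -> U) (h : R) (s : 'I_n -> V -> bool) :
  (forall v a, `|pt (v + e a) - pt v| <= h) ->
  (forall j v, v 0 j = 0 -> s j v = false) ->
  (forall j v, v 0 j = ord_max -> s j v = true) ->
  exists v, forall j, exists w a,
    [/\ s j (w + e a) != s j w, ~~ wraps j w a & `|pt w - pt v| <= h *+ n].
Proof.
move=> pth s0 s1.
have [n0|n0] := posnP n.
  by exists 0 => j; have := ltn_ord j; rewrite {2}n0.
have h0 : 0 <= h by apply: le_trans (pth 0 (Ordinal n0)).
have K2 : 2%N \in [pchar bool] by [].
pose w j v a : bool := wraps j v a + coboundary e (s j) v a.
have : cup_total e [seq w j | j <- enum 'I_n] != 0.
  by rewrite cup_total_cohomologous// ?cup_total_wraps//; exact: wraps_cocycle.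
move=> /eqP nz.
have [v nzv] : exists v, foldr (wedge e) (@topform _ _ _)
    [seq w j | j <- enum 'I_n] v finset.set0 != 0.
  apply/existsP; apply: contra_notT nz => /existsPn nz.
  by rewrite /cup_total big1// => v _; apply/eqP; rewrite -[_ == _]negbK nz.
exists v => j.
have [w' [a [wa dist]]] := foldr_wedge_neq0 h0 pth nzv (mem_enum _ j : j \in _).
exists w', a; move: dist; rewrite size_enum_ord => dist.
(* On a step closing the j-th circle, the label drops from 1 to 0, and this is
   compensated by the value 1 of the dual cocycle. *)
have nwrap : ~~ wraps j w' a.
  apply: contra wa => wr; have /andP[/eqP aj /eqP jmax] := wr.
  rewrite /w wr /coboundary (s1 _ _ jmax) s0//.
  by apply/ord_inj; rewrite aj torus_step_eq jmax /= modnn.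
split=> //; apply: contra wa => /eqP sE.
by rewrite /w (negbTE nwrap) /coboundary sE subrr.
Qed.

End DiscreteTorus.

(** * Folding the torus onto the cube *)

Section CubeZeros.
Variable R : realType.

Lemma rV_norm_leP m (x : 'rV[R]_m) (c : R) : 0 <= c ->
  `|x| <= c <-> forall j, `|x 0 j| <= c.
Proof.
move=> c0; rewrite [`|x|]/Num.Def.normr/= mx_normrE; split=> [/bigmax_leP[_ xc] j|xc].
  exact: (xc (0, j)).
by apply/bigmax_leP; split=> // -[i j] _ /=; rewrite (ord1 i).
Qed.

(** The circle Z/(2N+2) folded onto {0, ..., N+1}: going up, then coming back. *)
Definition fold_index (N k : nat) : nat := minn k (N.*2.+2 - k).

Lemma fold_index_step N k : (k < N.*2.+2)%N ->
  (fold_index N (k.+1 %% N.*2.+2) <= (fold_index N k).+1)%N /\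
  (fold_index N k <= (fold_index N (k.+1 %% N.*2.+2)).+1)%N.
Proof.
move=> kN; rewrite /fold_index.
have [->|kmax] := eqVneq k N.*2.+1; first by rewrite modnn; lia.
rewrite modn_small; lia.
Qed.

(** The cube of radius r, subdivided into N+1 intervals in each direction and
doubled by reflection. *)
Definition cube_point m (r : R) N (v : 'rV['I_N.*2.+2]_m) : 'rV[R]_m :=
  \row_j (r * (2 * (fold_index N (v 0 j))%:R / N.+1%:R - 1)).

Lemma cube_point_in m (r : R) N (v : 'rV['I_N.*2.+2]_m) : 0 <= r ->
  `|cube_point r v| <= r.
Proof.
move=> r0; apply/rV_norm_leP => // j; rewrite mxE normrM ger0_norm//.
rewrite ler_piMr// ler_norml.
have : ((fold_index N (v 0 j))%:R : R) <= N.+1%:R.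
  rewrite ler_nat /fold_index; have := ltn_ord (v 0 j); lia.
have N0 : (0 : R) < N.+1%:R by rewrite ltr0n.
move=> kN; rewrite -mulrA.
have : 0 <= (fold_index N (v 0 j))%:R / N.+1%:R :> R by rewrite divr_ge0.
have : (fold_index N (v 0 j))%:R / N.+1%:R <= 1 :> R.
  by rewrite ler_pdivrMr// mul1r.
by move: (_ / _) => t t1 t0; apply/andP; split; lra.
Qed.

Lemma cube_point_step m (r : R) N (v : 'rV['I_N.*2.+2]_m) a : 0 <= r ->
  `|cube_point r (v + delta_mx 0 a) - cube_point r v| <= 2 * r / N.+1%:R.
Proof.
move=> r0; have h0 : 0 <= 2 * r / N.+1%:R by rewrite divr_ge0// mulr_ge0.
apply/rV_norm_leP => // j.
pose k (w : 'rV['I_N.*2.+2]_m) : R := (fold_index N (w 0 j))%:R.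
have cubeE w : cube_point r w 0 j = r * (2 * k w / N.+1%:R - 1).
  by rewrite mxE.
rewrite mxE [(- _ : 'rV_m) 0 j]mxE !cubeE.
have kk : `|k (v + delta_mx 0 a) - k v| <= 1.
  rewrite /k; have [->|aj] := eqVneq a j; last first.
    by rewrite torus_step_neq// subrr normr0.
  rewrite torus_step_eq.
  have [k1 k2] := fold_index_step (ltn_ord (v 0 j)).
  by rewrite ler_distlC lerBlDr !natr1 !ler_nat k1 k2.
move: (k _) (k _) kk => k2 k1 kk.
have -> : r * (2 * k1 / N.+1%:R - 1) - r * (2 * k2 / N.+1%:R - 1) =
    2 * r / N.+1%:R * (k1 - k2) by ring.
by rewrite normrM ger0_norm// ler_piMr.
Qed.

(** The torus lemma applied to the label of v in direction j that is 1 if v lies in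
the reflected half, or if G_j is positive there.  When a label changes at the
turning point x_j = r because of the first clause, the sign of G_j is known from
the face condition. *)
Lemma miranda_approx m (r : R) (G : 'rV[R]_m -> 'rV[R]_m) (eps : R) :
  0 < r -> 0 < eps ->
  (forall (x : 'rV[R]_m) j, `|x| <= r -> x 0 j = - r -> G x 0 j <= 0) ->
  (forall (x : 'rV[R]_m) j, `|x| <= r -> x 0 j = r -> 0 <= G x 0 j) ->
  exists2 y, `|y| <= r & forall j, exists x x',
    [/\ `|x| <= r /\ `|x'| <= r, `|y - x| <= eps /\ `|y - x'| <= eps
      & G x 0 j <= 0 <= G x' 0 j].
Proof.
move=> r0 eps0 Gm Gp; have r0' := ltW r0.
pose N := Num.truncn (2 * r * m.+1%:R / eps).
pose h := 2 * r / N.+1%:R.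
have hm : h *+ m.+1 <= eps.
  rewrite /h -mulr_natr mulrAC ler_pdivrMr ?ltr0n// -ler_pdivrMl// mulrC.
  exact/ltW/truncnS_gt.
have h0 : 0 <= h by rewrite divr_ge0// mulr_ge0.
pose s j (v : 'rV['I_N.*2.+2]_m) :=
  (N.+1 <= v 0%R j)%N || (0 < G (cube_point r v) 0 j).
have [j v vj|j v vj|v Hv] :=
    @torus_labels_change N.*2 m R _ (@cube_point m r N) h s
      (fun v a => cube_point_step v a r0').
- apply/negbTE; rewrite /s negb_or vj/= -leNgt Gm ?cube_point_in//.
  by rewrite mxE vj /fold_index /= min0n mulr0 mul0r sub0r mulrN1.
- by rewrite /s vj /= ltnS -addnn leq_addr.
exists (cube_point r v); first exact: cube_point_in.
move=> j; have [w [a [sw nw dist]]] := Hv j.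
pose w' : 'rV_m := w + delta_mx 0 a.
have distw : `|cube_point r v - cube_point r w| <= eps.
  by rewrite distrC (le_trans dist)// (le_trans _ hm)// mulrSr lerDl.
have distw' : `|cube_point r v - cube_point r w'| <= eps.
  rewrite distrC -(subrKA (cube_point r w)) (le_trans (ler_normD _ _))//.
  by rewrite (le_trans _ hm)// mulrS lerD// cube_point_step.
have top (u : 'rV['I_N.*2.+2]_m) : u 0%R j = N.+1 :> nat -> 0 <= G (cube_point r u) 0 j.
  move=> uj; apply: Gp; first exact: cube_point_in.
  rewrite mxE uj /fold_index -addnn; have -> : minn N.+1 ((N + N).+2 - N.+1) = N.+1 by lia.
  by rewrite mulfK ?pnatr_eq0//; lra.
have step : w' 0%R j = w 0%R j :> nat \/ w' 0%R j = (w 0%R j).+1 :> nat.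
  have [aj|aj] := eqVneq a j; last by left; rewrite /w' torus_step_neq.
  have wmax : w 0 j != ord_max by apply: contra nw => wmax; rewrite /wraps aj eqxx.
  right; rewrite /w' aj torus_step_eq modn_small//.
  by rewrite ltnS ltn_neqAle -ltnS ltn_ord andbT.
move: sw; rewrite -/w' /s.
case: (leqP N.+1 (w 0%R j)) => /= wN; case: (leqP N.+1 (w' 0%R j)) => /= wN' //.
- by move: wN'; case: step => ->; rewrite ltnS leqNgt ?(ltnW wN) ?wN // ltnW.
- have wj : w' 0%R j = N.+1 :> nat.
    apply/eqP; rewrite eqn_leq wN' andbT.
    by case: step => ->; rewrite // ltnW.
  case: ltP => // Gw _.
  exists (cube_point r w), (cube_point r w'); split; rewrite ?cube_point_in//.
  by rewrite Gw top.
- case: ltP => Gw'; case: ltP => Gw // _.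
    exists (cube_point r w), (cube_point r w'); split; rewrite ?cube_point_in//.
    by rewrite Gw ltW.
  exists (cube_point r w'), (cube_point r w); split; rewrite ?cube_point_in//.
  by rewrite Gw' ltW.
Qed.
(** * The Poincare-Miranda theorem *)

Lemma closed_cube_compact m (r : R) : compact [set x : 'rV[R]_m | `|x| <= r].
Proof.
apply: bounded_closed_compact.
  by exists r; split; [exact: num_real | move=> M rM x /= /le_trans; apply; exact: ltW].
rewrite (_ : mkset _ = Num.norm @^-1` [set t | t <= r])//.
apply: closed_comp; last exact: closed_le.
by move=> x _; exact: norm_continuous.
Qed.

Lemma within_pos_nbhs (T : topologicalType) (A : set T) (g : T -> R) x :
  {within A, continuous g} -> A x -> 0 < g x ->
  \forall z \near x, A z -> 0 < g z.
Proof.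
move=> /subspace_continuousP gc Ax gx; have /= := gc x Ax.
by move=> /cvgr_gt /(_ _ gx); rewrite near_withinE.
Qed.

(** If G had no zero, each point of the cube would have a neighborhood on which one
fixed coordinate of G has constant strict sign; by compactness this contradicts
[miranda_approx] on a sufficiently fine scale. *)
Theorem poincare_miranda m (r : R) (G : 'rV[R]_m -> 'rV[R]_m) :
  0 < r -> {within [set x | `|x| <= r], continuous G} ->
  (forall (x : 'rV[R]_m) j, `|x| <= r -> x 0 j = - r -> G x 0 j <= 0) ->
  (forall (x : 'rV[R]_m) j, `|x| <= r -> x 0 j = r -> 0 <= G x 0 j) ->
  exists2 x, `|x| <= r & G x = 0.
Proof.
move=> r0 Gc Gm Gp; apply: contrapT => noz.
pose K := [set x : 'rV[R]_m | `|x| <= r].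
pose P (eps : R) (y : 'rV[R]_m) := forall j, exists x x',
  [/\ `|x| <= r /\ `|x'| <= r, `|y - x| <= eps /\ `|y - x'| <= eps
    & G x 0 j <= 0 <= G x' 0 j].
have coordc j : {within K, continuous (fun x => G x 0 j)}.
  move=> x; apply: (@continuous_comp (subspace K) _ _ G (fun M => M 0 j) x).
    exact: Gc.
  exact: coord_continuous.
have cov : \forall eps \near (0 : R)^'+, K `<=` (fun y => ~ P eps y).
  apply: ((compact_near_coveringP K).1 (@closed_cube_compact m r) R
    (0 : R)^'+ (fun eps y => ~ P eps y)) => x Kx.
  have [j /eqP Gxj] : exists j, G x 0 j <> 0.
    apply: contrapT => /forallNP Gx0; apply: noz; exists x => //.
    by apply/rowP => j; rewrite mxE; apply: contrapT; exact: Gx0.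
  have bad (Q : 'rV[R]_m -> Prop) : (\forall z \near x, K z -> Q z) ->
      \forall y \near x & eps \near (0 : R)^'+,
        forall z, `|z| <= r -> `|y - z| <= eps -> Q z.
    move=> /nbhs_normP[d /= d0 dQ].
    have d2 : 0 < d / 2 by rewrite divr_gt0.
    exists (ball x (d / 2), [set eps | eps < d / 2]).
      split; first exact: nbhsx_ballx.
      exact: nbhs_right_lt.
    move=> [y eps] [/= xy epsd] z Kz yz; apply: dQ => //=.
    rewrite -(subrKA y) (le_lt_trans (ler_normD _ _))// [d]splitr.
    rewrite ltrD//; first by move: xy; rewrite mx_norm_ball.
    exact: le_lt_trans epsd.
  have /orP[Gx|Gx] : (G x 0 j < 0) || (0 < G x 0 j) by rewrite -neq_lt.
  - have /bad : \forall z \near x, K z -> 0 < - G z 0 j.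
      apply: within_pos_nbhs => //; last by rewrite oppr_gt0.
      by move=> z; apply: continuousN; exact: coordc.
    apply: filterS => -[y eps] /= H /(_ j)[z [z' [[_ Kz'] [_ yz'] /andP[_ Gz']]]].
    by have := H z' Kz' yz'; rewrite oppr_gt0 ltNge Gz'.
  - have /bad : \forall z \near x, K z -> 0 < G z 0 j.
      exact: within_pos_nbhs.
    apply: filterS => -[y eps] /= H /(_ j)[z [z' [[Kz _] [yz _] /andP[Gz _]]]].
    by have := H z Kz yz; rewrite ltNge Gz.
have [eps [eps0 covP]] : exists eps : R, 0 < eps /\ K `<=` (fun y => ~ P eps y).
  apply: (@filter_ex _ (0 : R)^'+); near=> eps; split; last by near: eps.
  by near: eps; exact: nbhs_right_gt.
have [y Ky Py] := miranda_approx r0 eps0 Gm Gp.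
exact: covP y Ky Py.
Unshelve. all: by end_near. Qed.

Lemma linear_rV_continuous m (W : normedModType R) (f : {linear 'rV[R]_m -> W}) :
  continuous f.
Proof.
apply/linear_bounded_continuous/bounded_funP => r.
exists (r * \sum_j `|f (delta_mx 0 j)|) => x xr.
rewrite {1}(row_sum_delta x) linear_sum (le_trans (ler_norm_sum _ _ _))//.
rewrite mulr_sumr ler_sum// => j _; rewrite linearZ normrZ ler_wpM2r//.
have r0 : 0 <= r by apply: le_trans xr.
by move/(rV_norm_leP _ r0): xr; exact.
Qed.
End CubeZeros.

(** * The implicit function *)

(** Choose x in S a with norm within |a| of the infimum.  For a = 0 there is no
slack, but the infimum 0 is attained at 0. *)
Lemma near_minimal_selection (R : realType) (V W : normedZmodType R)
    (S : V -> set W) : S 0 0 ->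
  exists delta : V -> W, forall a x,
    S a x -> S a (delta a) /\ `|delta a| <= `|x| + `|a|.
Proof.
move=> S00; suff /choice[delta deltaP] : forall a, exists d, forall x,
    S a x -> S a d /\ `|d| <= `|x| + `|a| by exists delta.
move=> a; have [->|a0] := eqVneq a 0.
  by exists 0 => x _; rewrite !normr0 addr0.
have [[x0 Sx0]|noS] := pselect (exists x, S a x); last first.
  by exists 0 => x Sx; case: noS; exists x.
pose E := [set `|x| | x in S a].
have Elb : has_lbound E by exists 0 => _ [x _ <-].
have [||_ [d Sd <-] dE] := @inf_adherent R E `|a|.
- by rewrite normr_gt0.
- by split=> //; exists `|x0|, x0.
exists d => x Sx; split=> //; apply: (le_trans (ltW dE)).
by rewrite lerD2r ge_inf//; exists x.
Qed.

(** Poincare-Miranda for d |-> g (F (d, a)), which is within r of the identity on the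
cube of radius r: r / 2 accounts for the differentiability error at a = 0, and
r / 2 for the variation in a. *)
Lemma small_zeros (R : realType) (m n : nat)
    (F : 'rV[R]_m * 'rV[R]_n -> 'rV[R]_m) (eps : R) :
  (\forall z \near (0 : 'rV[R]_m * 'rV[R]_n), {for z, continuous F}) ->
  F (0, 0) = 0 ->
  differentiable (fun d : 'rV[R]_m => F (d, 0)) (0 : 'rV[R]_m) ->
  bijective ('d (fun d : 'rV[R]_m => F (d, 0)) (0 : 'rV[R]_m)) ->
  0 < eps ->
  \forall a \near (0 : 'rV[R]_n), exists2 d, F (d, a) = 0 & `|d| <= eps.
Proof.
move=> Fcont F0 Fdiff [g0 Lg gL] eps0.
pose f (d : 'rV[R]_m) := F (d, 0).
have {g0 Lg gL} [g Lg gL] : exists2 g : {linear 'rV[R]_m -> 'rV[R]_m},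
    cancel ('d f 0) g & cancel g ('d f 0).
  pose g : {linear 'rV[R]_m -> 'rV[R]_m} := HB.pack g0
    (GRing.isLinear.Build _ _ _ _ g0 (can2_linear Lg gL)).
  by exists g.
have gc : continuous g by exact: linear_rV_continuous.
have [C C0 gC] : exists2 C : R, 0 < C & forall x, `|g x| <= C * `|x|.
  have /linear_boundedP/pinfty_ex_gt0[C C0 gC] :=
    (linear_bounded_continuous g).2 gc.
  by exists C.
have close : \forall d \near (0 : 'rV[R]_m), `|g (f d) - d| <= 2^-1 * `|d|.
  have /eqaddoP/(_ (2^-1 / C)) := diff_locally Fdiff.
  rewrite divr_gt0 ?invr_gt0// => /(_ isT); apply: filterS => d.
  rewrite !fctE /= addr0 F0 add0r => fd.
  have -> : g (f d) - d = g (f d - 'd f 0 d) by rewrite linearB Lg.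
  rewrite (le_trans (gC _))//.
  by rewrite -ler_pdivlMl// mulrA [C^-1 * _]mulrC.
have [rho rho0 Frho] : exists2 rho : R, 0 < rho &
    forall d a, `|d| < rho -> `|a| < rho -> {for (d, a), continuous F}.
  move: Fcont => /nbhs_ballP[rho /= rho0 Frho]; exists rho => // d a dr ar.
  apply: Frho; split; rewrite /= mx_norm_ball /ball_ /=.
    by rewrite sub0r normrN.
  by rewrite sub0r normrN.
move: close => /nbhs_norm0P[rho' /= rho'0 close].
(* The three bounds make the solution small, F continuous on the cube, and the
   differentiability estimate valid there. *)
have [r r0 [reps rrho rrho']] : exists2 r : R, 0 < r &
    [/\ r <= eps, r < rho & r < rho'].
  exists (Num.min eps (Num.min (rho / 2) (rho' / 2))).
    by rewrite !lt_min eps0 !divr_gt0.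
  split; first by rewrite ge_min lexx.
    by rewrite !gt_min ltr_pdivrMr// mulr_natr mulr2n ltrDl rho0 orbT.
  by rewrite !gt_min [rho' / 2 < _]ltr_pdivrMr// mulr_natr mulr2n ltrDl rho'0 !orbT.
pose K := [set x : 'rV[R]_m | `|x| <= r].
(* Uniformity in d over the compact cube, from joint continuity. *)
have unif : \forall a \near (0 : 'rV[R]_n),
    K `<=` (fun d => `|g (F (d, a)) - g (F (d, 0))| <= r / 2).
  apply: ((compact_near_coveringP K).1 (@closed_cube_compact R m r) _
    (nbhs (0 : 'rV[R]_n))
    (fun a d => `|g (F (d, a)) - g (F (d, 0))| <= r / 2)) => d Kd.
  pose H (p : 'rV[R]_m * 'rV[R]_n) := g (F p) - g (F (p.1, 0)).
  have Fd : {for (d, 0), continuous F}.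
    by apply: Frho; rewrite ?normr0//; exact: le_lt_trans rrho.
  have Hc : H p @[p --> (d, 0 : 'rV[R]_n)] --> H (d, 0).
    have F1 : {for (d, 0), continuous (fun p : 'rV[R]_m * 'rV[R]_n => F (p.1, 0))}.
      apply: (@continuous_comp _ _ _ (fun p : 'rV[R]_m * 'rV[R]_n =>
        (p.1, 0 : 'rV[R]_n)) F); last exact: Fd.
      apply: (@cvg_pair _ _ _ _ (nbhs d) (nbhs (0 : 'rV[R]_n))); first exact: cvg_fst.
      exact: cvg_cst.
    exact: cvgB (continuous_comp Fd (gc _)) (continuous_comp F1 (gc _)).
  have r2 : 0 < r / 2 by rewrite divr_gt0.
  have /cvgr_norm_lt/(_ (r / 2)) := Hc.
  rewrite [H _]subrr normr0 => /(_ r2); apply: filterS => -[d' a] /=.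
  exact: ltW.
near=> a.
have aunif : K `<=` (fun d => `|g (F (d, a)) - g (F (d, 0))| <= r / 2).
  by near: a.
have arho : `|a| < rho by near: a; exact: (@nbhs0_lt R 'rV[R]_n).
pose G d := g (F (d, a)).
have Gd d : `|d| <= r -> `|G d - d| <= r.
  move=> dr; rewrite -(subrKA (g (F (d, 0)))) (le_trans (ler_normD _ _))//.
  rewrite [leRHS]splitr lerD//; first exact: aunif.
  have dd : `|d| < rho' by apply: le_lt_trans rrho'.
  by rewrite (le_trans (close d dd))// mulrC ler_pM2r ?invr_gt0.
have Gdj (d : 'rV[R]_m) j : `|d| <= r -> d 0 j - r <= G d 0 j <= d 0 j + r.
  move=> dr; have := Gd d dr; move/(rV_norm_leP _ (ltW r0)) => /(_ j).
  by rewrite !mxE ler_distl.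
have [||d j dr dj|d j dr dj|d dr Gd0] := @poincare_miranda R m r G => //.
- apply: continuous_in_subspaceT => d /set_mem /= dr.
  have Fda : {for d, continuous (fun d => F (d, a))}.
    apply: (@continuous_comp _ _ _ (fun d => (d, a)) F).
      have cd := cvg_pair (@cvg_id _ (nbhs d)) (@cvg_cst _ a _ (nbhs d) _).
      exact: cd.
    by apply: Frho => //; exact: le_lt_trans rrho.
  exact: continuous_comp Fda (gc _).
- by have /andP[_] := Gdj d j dr; rewrite dj addNr.
- by have /andP[+ _] := Gdj d j dr; rewrite dj subrr.
exists d; last exact: le_trans reps.
by rewrite -(gL (F (d, a))) -/(G d) Gd0 linear0.
Unshelve. all: by end_near. Qed.

Theorem lemma2p27 (R : realType) (m n : nat)
    (F : 'rV[R]_m * 'rV[R]_n -> 'rV[R]_m)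
    (Fcont : \forall z \near (0 : 'rV[R]_m * 'rV[R]_n), {for z, continuous F})
    (F0 : F (0, 0) = 0)
    (Fdiff : differentiable (fun d : 'rV[R]_m => F (d, 0)) (0 : 'rV[R]_m))
    (Finv : bijective ('d (fun d : 'rV[R]_m => F (d, 0)) (0 : 'rV[R]_m))) :
  exists delta : 'rV[R]_n -> 'rV[R]_m,
    [/\ \forall a \near (0 : 'rV[R]_n), F (delta a, a) = 0,
        delta 0 = 0 &
        {for (0 : 'rV[R]_n), continuous delta}].
Proof.
have [delta deltaP] :=
  @near_minimal_selection R _ _ (fun a d => F (d, a) = 0) F0.
have zeros (eps : R) := small_zeros Fcont F0 Fdiff Finv (eps := eps).
have delta0 : delta 0 = 0.
  have [_] := deltaP 0 0 F0; rewrite !normr0 addr0 => d0.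
  by apply/eqP; rewrite -normr_le0.
exists delta; split=> //.
  apply: filterS (zeros 1 ltr01) => a [d Fd _].
  by have [] := deltaP a d Fd.
rewrite /prop_for /continuous_at delta0.
apply/(@cvgr0Pnorm_lt R 'rV[R]_m _ (nbhs (0 : 'rV[R]_n))) => eps eps0.
have eps2 : 0 < eps / 2 by rewrite divr_gt0.
near=> a.
have [d Fd dle] : exists2 d, F (d, a) = 0 & `|d| <= eps / 2.
  by near: a; exact: zeros.
have [_ /le_lt_trans] := deltaP a d Fd; apply.
rewrite [ltRHS]splitr; apply: ler_ltD => //.
Unshelve. all: by end_near. Qed.
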